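(* Let $F$ be a field of characteristic not two and let $E$ be a finite-dimensional vector space over $F$ with an arbitrary symmetric bilinear form $(U,V)\mapsto U\cdot V$. Suppose the non-null projective triangle $\overline{uvw}$ in $E$ has projective quadrances $q_u=q(v,w)$, $q_v=q(u,w)$, $q_w=q(u,v)$, and projective spreads $S_u=S(uv,uw)$, $S_v=S(vw,vu)$, $S_w=S(wu,wv)$ (all three assumed to be defined). Then $$\left(S_wq_uq_v-q_u-q_v-q_w+2\right)^2=4(1-q_u)(1-q_v)(1-q_w).$$
   Context: A projective point $u=[U]$ is a one-dimensional subspace of $E$, spanned by a non-zero vector $U$; it is null if $U\cdot U=0$, and non-null otherwise. For distinct projective points $u,v$, $uv$ denotes the projective line (two-dimensional subspace) they span. A projective triangle $\overline{uvw}$ is a set of three distinct projective points not contained in a common two-dimensional subspace; it is null if at least one of its projective points is null, and non-null otherwise. The projective quadrance between non-null projective points $u=[U]$, $v=[V]$ is $$q(u,v)=1-\frac{(U\cdot V)^2}{(U\cdot U)(V\cdot V)}.$$ The projective spread between the projective lines $wu$ and $wv$, where $u=[U]$, $v=[V]$, $w=[W]$ with $w$ non-null, is, putting $U'=U-\frac{U\cdot W}{W\cdot W}W$ and $V'=V-\frac{V\cdot W}{W\cdot W}W$, $$S(wu,wv)=1-\frac{(U'\cdot V')^2}{(U'\cdot U')(V'\cdot V')},$$ and it is undefined if one of the denominators is zero. Equivalently, with $a_X=X\cdot X$ and $b_{XY}=X\cdot Y$, $$S(wu,wv)=1-\frac{(a_Wb_{UV}-b_{UW}b_{VW})^2}{(a_Ua_W-b_{UW}^2)(a_Va_W-b_{VW}^2)}.$$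 The bilinear form is not assumed non-degenerate. *)

(* Defs.v *)
From HB Require Import structures.
From mathcomp Require Import all_boot all_order all_algebra.

Set Implicit Arguments.
Unset Strict Implicit.
Unset Printing Implicit Defensive.

Import GRing.Theory.
Local Open Scope ring_scope.

Record ppoint (F : fieldType) (E : vectType F) :=
  PPoint { ppoint_space :> {vspace E}; _ : \dim ppoint_space == 1%N }.

HB.instance Definition _ (F : fieldType) (E : vectType F) :=
  [isSub for @ppoint_space F E].
HB.instance Definition _ (F : fieldType) (E : vectType F) :=
  [Choice of ppoint E by <:].

(* A spanning vector of the point, chosen once and for all; the notions below
   do not depend on this choice: see [null_vline], [quadrance_vline],
   [spread_lines] and [spread_defined_lines]. *)
Definition spanv (F : fieldType) (E : vectType F) (u : ppoint E) : E :=
  vpick u.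

Definition null (F : fieldType) (E : vectType F) (B : {symmetric E})
    (u : ppoint E) : bool :=
  B (spanv u) (spanv u) == 0.

Definition triangle (F : fieldType) (E : vectType F) (u v w : ppoint E) : Prop :=
  [/\ u != v, v != w, u != w &
      forall L : {vspace E}, \dim L = 2%N -> ~~ (u + v + w <= L)%VS].

Definition nonnull_triangle (F : fieldType) (E : vectType F)
    (B : {symmetric E}) (u v w : ppoint E) : Prop :=
  triangle u v w /\ [/\ ~~ null B u, ~~ null B v & ~~ null B w].

(* Only meaningful when u and v are non-null. *)
Definition quadrance (F : fieldType) (E : vectType F) (B : {symmetric E})
    (u v : ppoint E) : F :=
  let U := spanv u in let V := spanv v in
  1 - B U V ^+ 2 / (B U U * B V V).

Definition perp_part (F : fieldType) (E : vectType F) (B : {symmetric E})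
    (W U : E) : E :=
  U - (B U W / B W W) *: W.

(* [spread B w u v] is the spread S(wu, wv) between the lines wu and wv; it is
   only meaningful when [spread_defined B w u v] holds. *)
Definition spread_defined (F : fieldType) (E : vectType F) (B : {symmetric E})
    (w u v : ppoint E) : bool :=
  let U' := perp_part B (spanv w) (spanv u) in
  let V' := perp_part B (spanv w) (spanv v) in
  [&& ~~ null B w, B U' U' != 0 & B V' V' != 0].

Definition spread (F : fieldType) (E : vectType F) (B : {symmetric E})
    (w u v : ppoint E) : F :=
  let U' := perp_part B (spanv w) (spanv u) in
  let V' := perp_part B (spanv w) (spanv v) in
  1 - B U' V' ^+ 2 / (B U' U' * B V' V').

Section Independence.
Variables (F : fieldType) (E : vectType F) (B : {symmetric E}).
Implicit Types u v w : ppoint E.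

Lemma spanvE u : u = <[spanv u]>%VS :> {vspace E}.
Proof.
apply/esym/eqP; rewrite eqEdim -memvE memv_pick /= dim_vline vpick0.
by case: u => u /= /eqP du; rewrite du -dimv_eq0 du.
Qed.

Lemma spanv_neq0 u : spanv u != 0.
Proof. by rewrite vpick0 -dimv_eq0; case: u => u /= /eqP ->. Qed.

Lemma spanv_vline u (U : E) : u = <[U]>%VS :> {vspace E} ->
  exists2 k, k != 0 & spanv u = k *: U.
Proof.
move=> uU; have /vlineP[k kE] : spanv u \in <[U]>%VS by rewrite -uU memv_pick.
exists k => //; apply: contraNneq (spanv_neq0 u) => k0.
by rewrite kE k0 scale0r.
Qed.

Lemma formZZ (a b : F) (X Y : E) : B (a *: X) (b *: Y) = a * b * B X Y.
Proof. by rewrite linearZl_LR linearZr_LR /= mulrA. Qed.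

Lemma symC (X Y : E) : B X Y = B Y X.
Proof. by rewrite hermC /= expr0 mul1r. Qed.

Lemma null_vline u (U : E) : u = <[U]>%VS :> {vspace E} ->
  null B u = (B U U == 0).
Proof.
case/spanv_vline=> k k0 uE.
by rewrite /null uE formZZ !mulf_eq0 (negPf k0).
Qed.

Lemma ratioZ (a b : F) (X Y : E) : a != 0 -> b != 0 ->
  B (a *: X) (b *: Y) ^+ 2 / (B (a *: X) (a *: X) * B (b *: Y) (b *: Y)) =
  B X Y ^+ 2 / (B X X * B Y Y).
Proof.
move=> a0 b0; rewrite !formZZ.
have -> : a * a * B X X * (b * b * B Y Y) = (a * b) ^+ 2 * (B X X * B Y Y).
  by rewrite mulrACA [a * a * _]mulrACA -expr2.
by rewrite exprMn -mulf_div divff ?mul1r // expf_neq0 ?mulf_neq0.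
Qed.

Lemma quadrance_vline u v (U V : E) :
  u = <[U]>%VS :> {vspace E} -> v = <[V]>%VS :> {vspace E} ->
  quadrance B u v = 1 - B U V ^+ 2 / (B U U * B V V).
Proof.
case/spanv_vline=> a a0 uE; case/spanv_vline=> b b0 vE.
by rewrite /quadrance uE vE /= ratioZ.
Qed.

Lemma perp_partD (W X Y : E) :
  perp_part B W (X + Y) = perp_part B W X + perp_part B W Y.
Proof. by rewrite /perp_part linearDl /= mulrDl scalerDl opprD addrACA. Qed.

Lemma perp_partZ (W X : E) (k : F) :
  perp_part B W (k *: X) = k *: perp_part B W X.
Proof. by rewrite /perp_part linearZl_LR /= -mulrA scalerBr scalerA. Qed.

Lemma perp_partZl (W X : E) (k : F) : k != 0 ->
  perp_part B (k *: W) X = perp_part B W X.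
Proof.
move=> k0; rewrite /perp_part scalerA formZZ linearZr_LR /=; congr (_ - _ *: _).
by rewrite mulrAC [k * _ * k]mulrAC -mulf_div divff ?mul1r // mulf_neq0.
Qed.

Lemma perp_part_self (W : E) : B W W != 0 -> perp_part B W W = 0.
Proof. by move=> W0; rewrite /perp_part divff // scale1r subrr. Qed.

Lemma perp_part_line w u (W U : E) : ~~ null B w ->
  w = <[W]>%VS :> {vspace E} -> (w + u = <[W]> + <[U]>)%VS ->
  exists2 k, k != 0 &
    perp_part B (spanv w) (spanv u) = k *: perp_part B W U.
Proof.
move=> nw wW luU; have WW : B W W != 0 by rewrite -(null_vline wW).
have perpW X : X \in <[W]>%VS -> perp_part B W X = 0.
  by case/vlineP=> k ->; rewrite perp_partZ perp_part_self ?scaler0.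
have [c c0 ->] := spanv_vline wW; rewrite perp_partZl //.
have : spanv u \in (<[W]> + <[U]>)%VS.
  by rewrite -luU (subvP (addvSr _ _)) ?memv_pick.
case/memv_addP=> _ /vlineP[a ->] [_ /vlineP[k ->] uE].
have {}uE : perp_part B W (spanv u) = k *: perp_part B W U.
  by rewrite uE perp_partD !perp_partZ perp_part_self // scaler0 add0r.
have [k0|k0] := eqVneq k 0; last by exists k.
have u0 : perp_part B W (spanv u) = 0 by rewrite uE k0 scale0r.
exists 1; rewrite ?oner_neq0 // scale1r u0; apply/esym.
have : U \in (w + u)%VS by rewrite luU (subvP (addvSr _ _)) ?memv_line.
case/memv_addP=> X Xw [Y]; rewrite spanvE => /vlineP[b ->] ->.
by rewrite perp_partD perp_partZ u0 scaler0 addr0 perpW // -wW.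
Qed.

Lemma spread_lines w u v (W U V : E) : ~~ null B w ->
  w = <[W]>%VS :> {vspace E} ->
  (w + u = <[W]> + <[U]>)%VS -> (w + v = <[W]> + <[V]>)%VS ->
  let U' := perp_part B W U in let V' := perp_part B W V in
  spread B w u v = 1 - B U' V' ^+ 2 / (B U' U' * B V' V').
Proof.
move=> nw wW uU vV /=.
have [a a0 uE] := perp_part_line nw wW uU.
have [b b0 vE] := perp_part_line nw wW vV.
by rewrite /spread uE vE /= ratioZ.
Qed.

Lemma spread_defined_lines w u v (W U V : E) : ~~ null B w ->
  w = <[W]>%VS :> {vspace E} ->
  (w + u = <[W]> + <[U]>)%VS -> (w + v = <[W]> + <[V]>)%VS ->
  let U' := perp_part B W U in let V' := perp_part B W V in
  spread_defined B w u v = (B U' U' != 0) && (B V' V' != 0).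
Proof.
move=> nw wW uU vV /=.
have [a a0 uE] := perp_part_line nw wW uU.
have [b b0 vE] := perp_part_line nw wW vV.
by rewrite /spread_defined nw uE vE /= !formZZ !mulf_eq0 (negPf a0) (negPf b0).
Qed.

End Independence.

(* Main.v *)
Require Import Defs.
From HB Require Import structures.
From mathcomp Require Import all_boot all_order all_algebra.
From mathcomp Require Import ring.

Set Implicit Arguments.
Unset Strict Implicit.
Unset Printing Implicit Defensive.

Import GRing.Theory.
Local Open Scope ring_scope.

(** Choose spanning vectors U, V, W and write U', V' for the parts of U and V
    orthogonal to W. Since [U'.U' = (U.U) q_v] and [V'.V' = (V.V) q_u]
    ([perp_part_norm]), multiplying the spread at w by [q_u q_v] cancels its
    denominators ([spread_mul_quadrances]):
    [S_w q_u q_v = q_u q_v - (U'.V')^2 / ((U.U) (V.V))],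
    where [U'.V' = U.V - (U.W)(V.W)/(W.W)]. Expanding, [S_w q_u q_v] is the Gram
    determinant of U, V, W divided by [(U.U)(V.V)(W.W)], that is
    [1 - (1 - q_u) - (1 - q_v) - (1 - q_w) + 2 P] with
    [P = (U.V)(V.W)(U.W) / ((U.U)(V.V)(W.W))]. The expression to be squared is
    thus exactly [2 P], and [P^2 = (1 - q_u)(1 - q_v)(1 - q_w)] because each
    product of two distinct vectors occurs squared in exactly one of the
    [1 - q]. *)

Section ProjectiveTrigonometry.
Variables (F : fieldType) (E : vectType F) (B : {symmetric E}).
Implicit Types u v w : ppoint E.

Lemma form_perp_part (W X Y : E) : B W W != 0 ->
  B (perp_part B W X) (perp_part B W Y) = B X Y - B X W * B Y W / B W W.
Proof.
move=> W0; rewrite /perp_part linearBl linearBr /= linearBr /=.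
rewrite !linearZl_LR !linearZr_LR /= (symC B W Y).
by field.
Qed.

(** The quadrance is the fraction of the norm that survives projection along
    W, as the squared sine is in Euclidean geometry. *)
Lemma perp_part_norm w u : ~~ null B w -> ~~ null B u ->
  let U' := perp_part B (spanv w) (spanv u) in
  B U' U' = B (spanv u) (spanv u) * quadrance B u w.
Proof.
rewrite /null /quadrance => w0 u0 /=; rewrite form_perp_part //.
by field; rewrite u0 w0.
Qed.

(** By [perp_part_norm] the denominator of the spread is
    [(U.U) (V.V) q_u q_v], so the factors [q_u q_v] cancel; they are non-zero
    because the spread is defined. *)
Lemma spread_mul_quadrances u v w :
  ~~ null B u -> ~~ null B v -> spread_defined B w u v ->
  let U := spanv u in let V := spanv v in let W := spanv w in
  spread B w u v * quadrance B v w * quadrance B u w =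
  quadrance B v w * quadrance B u w -
    (B U V - B U W * B V W / B W W) ^+ 2 / (B U U * B V V).
Proof.
move=> u0 v0 /and3P[w0 U'0 V'0] /=.
move: U'0 V'0; rewrite /spread !perp_part_norm // form_perp_part //.
rewrite !mulf_eq0 !negb_or => /andP[UU0 qu0] /andP[VV0 qv0].
move: (quadrance B u w) (quadrance B v w) qu0 qv0 => q p q0 p0.
by field; rewrite UU0 VV0 p0 q0 w0.
Qed.

End ProjectiveTrigonometry.

Theorem theorem11 (F : fieldType) (char_neq2 : 2%N \notin [pchar F])
  (E : vectType F) (B : {symmetric E}) (u v w : ppoint E)
  (q_u q_v q_w S_u S_v S_w : F) :
  nonnull_triangle B u v w ->
  q_u = quadrance B v w -> q_v = quadrance B u w -> q_w = quadrance B u v ->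
  spread_defined B u v w -> S_u = spread B u v w ->
  spread_defined B v w u -> S_v = spread B v w u ->
  spread_defined B w u v -> S_w = spread B w u v ->
  (S_w * q_u * q_v - q_u - q_v - q_w + 2%:R) ^+ 2
    = 4%:R * (1 - q_u) * (1 - q_v) * (1 - q_w).
Proof.
move=> [_ [u0 v0 w0]] -> -> -> _ _ _ _ defS ->.
rewrite spread_mul_quadrances // /quadrance.
by field; rewrite u0 v0 w0.
Qed.
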